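(* Let $G$ be a finite group acting by isometries on a complete CAT(0) space $X$, or by automorphisms of an arbitrary CAT(0) cubical complex $C$. Then the fixed point set for $G$ is contractible (in particular, non-empty).
   Context: CAT(0) spaces are non-empty geodesic metric spaces in which every geodesic triangle is at least as thin as its Euclidean comparison triangle. A cubical complex is obtained by gluing Euclidean cubes of side length 1 along faces by isometries so that each closed cube embeds and any two closed cubes meet in the empty set or a single common face, with the induced path metric (infimum of lengths of piecewise linear paths). The cubical complex $C$ is not assumed finite-dimensional, locally finite or metrically complete. *)

(* Defs.v *)
From HB Require Import structures.
From mathcomp Require Import all_boot all_order all_algebra.
From mathcomp Require Import fingroup action.
From mathcomp Require Import all_classical all_reals all_analysis.

Set Implicit Arguments.
Unset Strict Implicit.
Unset Printing Implicit Defensive.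

Import Order.TTheory GRing.Theory Num.Theory.
Import numFieldTopology.Exports.

Local Open Scope classical_set_scope.
Local Open Scope ring_scope.

(* The library norm on 'rV[R]_n is the sup norm, hence this definition. *)
Definition eucl_dist (R : realType) (n : nat) (x y : 'rV[R]_n) : R :=
  Num.sqrt (\sum_(i < n) (x ord0 i - y ord0 i) ^+ 2).

Definition isometry_onto (R : realType) (m n : nat)
    (A : set 'rV[R]_m) (B : set 'rV[R]_n) (h : 'rV[R]_m -> 'rV[R]_n) : Prop :=
  h @` A = B /\
  forall x y, A x -> A y -> eucl_dist (h x) (h y) = eucl_dist x y.

Definition geodesic (R : realType) (X : metricType R) (x y : X) (c : R -> X)
    : Prop :=
  [/\ c 0 = x, c (mdist x y) = y &
      forall s t, 0 <= s <= mdist x y -> 0 <= t <= mdist x y ->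
        mdist (c s) (c t) = `|s - t|].

Definition geodesic_space (R : realType) (X : metricType R) : Prop :=
  forall x y : X, exists c, geodesic x y c.

(* Indices are cyclic: side i joins vertex i to vertex i + 1 mod 3. *)
Definition geodesic_triangle (R : realType) (X : metricType R)
    (v : 'I_3 -> X) (c : 'I_3 -> R -> X) : Prop :=
  forall i, geodesic (v i) (v (ordS i)) (c i).

Definition comparison_triangle (R : realType) (X : metricType R)
    (v : 'I_3 -> X) (w : 'I_3 -> 'rV[R]_2) : Prop :=
  forall i j, eucl_dist (w i) (w j) = mdist (v i) (v j).

Definition side_point (R : realType) (X : metricType R)
    (v : 'I_3 -> X) (c : 'I_3 -> R -> X) (i : 'I_3) (t : R) : X :=
  c i (t * mdist (v i) (v (ordS i))).

Definition comparison_point (R : realType) (w : 'I_3 -> 'rV[R]_2)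
    (i : 'I_3) (t : R) : 'rV[R]_2 :=
  (1 - t) *: w i + t *: w (ordS i).

(* Points are parametrized by the fraction of the side already covered, so
   [comparison_point w i t] is the point of the comparison side whose distances
   to the endpoints are those of [side_point v c i t]. *)
Definition CAT0 (R : realType) (X : metricType R) : Prop :=
  [/\ [set: X] !=set0, geodesic_space X &
      forall (v : 'I_3 -> X) (c : 'I_3 -> R -> X) (w : 'I_3 -> 'rV[R]_2),
        geodesic_triangle v c -> comparison_triangle v w ->
        forall (i j : 'I_3) (s t : R), 0 <= s <= 1 -> 0 <= t <= 1 ->
          mdist (side_point v c i s) (side_point v c j t) <=
          eucl_dist (comparison_point w i s) (comparison_point w j t)].

(* The library's complete uniform spaces are pointed, which a metricType
   need not be. *)
Definition complete_space (R : realType) (X : metricType R) : Prop :=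
  forall u : nat -> X, cauchy (u @ \oo) -> exists l : X, u @ \oo --> l.

Definition cube (R : realType) (n : nat) : set 'rV[R]_n :=
  [set x | forall i, 0 <= x ord0 i <= 1].

(* A face is obtained by fixing some coordinates to 0 or 1: [F i = Some b]
   fixes coordinate i to b, and [F i = None] leaves it free.  The cube itself
   is a face. *)
Definition face (R : realType) (n : nat) (F : {ffun 'I_n -> option bool})
    : set 'rV[R]_n :=
  [set x | cube x /\ forall i b, F i = Some b -> x ord0 i = (nat_of_bool b)%:R].
Arguments face R [n] F _.

(* A quotient of a disjoint union of cubes, presented by the restrictions
   [char l] of the projection to the cubes; [char l] is only meaningful on
   [cube].  Two cubes are disjoint or glued along one face of each by an
   isometry.  No bound is put on the dimensions [dim l], nor on the number of
   cubes. *)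
Record cubical_complex (R : realType) (K : Type) := CubicalComplex {
  cell : Type;
  dim : cell -> nat;
  char : forall l : cell, 'rV[R]_(dim l) -> K;
  char_surj : forall k : K, exists (l : cell) (x : 'rV[R]_(dim l)),
    cube x /\ char x = k;
  char_inj : forall (l : cell) (x y : 'rV[R]_(dim l)),
    cube x -> cube y -> char x = char y -> x = y;
  char_glue : forall l m : cell,
    (exists (x : 'rV[R]_(dim l)) (y : 'rV[R]_(dim m)),
       [/\ cube x, cube y & char x = char y]) ->
    exists (F : {ffun 'I_(dim l) -> option bool})
           (F' : {ffun 'I_(dim m) -> option bool})
           (h : 'rV[R]_(dim l) -> 'rV[R]_(dim m)),
      isometry_onto (face R F) (face R F') h /\
      forall (x : 'rV[R]_(dim l)) (y : 'rV[R]_(dim m)), cube x -> cube y ->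
        (char x = char y <-> face R F x /\ y = h x)
}.

(* [pl_path C x y len]: a finite concatenation of straight segments, each
   contained in a closed cube, leads from x to y and has total length len. *)
Inductive pl_path (R : realType) (K : Type) (C : cubical_complex R K)
    : K -> K -> R -> Prop :=
| pl_path_const (x : K) : pl_path C x x 0
| pl_path_segment (l : cell C) (a b : 'rV[R]_(dim l)) (y : K) (len : R) :
    cube a -> cube b -> pl_path C (char b) y len ->
    pl_path C (char a) y (eucl_dist a b + len).

(* Extended-real valued, so that it is +oo between points that no path joins. *)
Definition path_dist (R : realType) (K : Type) (C : cubical_complex R K)
    (x y : K) : \bar R :=
  ereal_inf [set len%:E | len in [set len : R | pl_path C x y len]].

Definition has_path_metric (R : realType) (K : metricType R)
    (C : cubical_complex R K) : Prop :=
  forall x y : K, (mdist x y)%:E = path_dist C x y.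

Definition maps_cubes (R : realType) (K : Type) (C : cubical_complex R K)
    (f : K -> K) : Prop :=
  forall l : cell C, exists (m : cell C)
      (F : {ffun 'I_(dim m) -> option bool})
      (h : 'rV[R]_(dim l) -> 'rV[R]_(dim m)),
    isometry_onto (@cube R (dim l)) (face R F) h /\
    forall x : 'rV[R]_(dim l), cube x -> f (char x) = char (h x).

(* The closed cubes of C are the images of all faces of the [char l], so the
   target of a cube is allowed to be a face of some [char m]. *)
Definition automorphism (R : realType) (K : Type) (C : cubical_complex R K)
    (f : K -> K) : Prop :=
  exists g : K -> K,
    [/\ cancel f g, cancel g f, maps_cubes C f & maps_cubes C g].

Definition acts_by_isometries (R : realType) (gT : finGroupType)
    (X : metricType R) (to : {action gT &-> X}) : Prop :=
  forall (g : gT) (x y : X), mdist (to x g) (to y g) = mdist x y.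

Definition acts_by_automorphisms (R : realType) (gT : finGroupType) (K : Type)
    (C : cubical_complex R K) (to : {action gT &-> K}) : Prop :=
  forall g : gT, automorphism C (fun x => to x g).

(* The library's 'Fix requires a finite carrier. *)
Definition fixed_points (gT : finGroupType) (X : Type)
    (to : {action gT &-> X}) : set X :=
  [set x | forall g : gT, to x g = x].

(* Contractibility of A in its subspace topology; it forces A to be non-empty. *)
Definition contractible (R : realType) (X : topologicalType) (A : set X)
    : Prop :=
  exists (a : X) (H : R * X -> X),
    [/\ A a,
        {within `[0, 1]%classic `*` A, continuous H},
        forall t x, 0 <= t <= 1 -> A x -> A (H (t, x)),
        forall x, A x -> H (0, x) = x &
        forall x, A x -> H (1, x) = a].

(* Main.v *)
Require Import Defs.
From mathcomp Require Import all_boot all_order all_algebra.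
From mathcomp Require Import fingroup action.
From mathcomp Require Import all_classical all_reals all_analysis.
From mathcomp Require Import ring lra.
Import Defs.

Set Implicit Arguments.
Unset Strict Implicit.
Unset Printing Implicit Defensive.

Import Order.TTheory GRing.Theory Num.Theory.
Import numFieldTopology.Exports.

Local Open Scope classical_set_scope.
Local Open Scope ring_scope.


(** Contractibility of the fixed point set reduces to the existence of one
    fixed point [a]: a group element fixing [x] and [a] maps the geodesic from
    [x] to [a] to a geodesic with the same ends, hence to itself, so sliding
    along geodesics to [a] contracts the fixed point set
    ([fixed_points_contractible]).

    To find fixed points, consider the sum of the squared distances to the
    points of an orbit.  The CAT(0) midpoint inequality makes this function
    uniformly convex, so points at which it is close to its infimum are close
    to each other ([almost_center_close]); as the function is invariant, such a
    point is moved very little by every group element ([almost_fixed_point]).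
    In a complete space a minimizing sequence converges to a fixed point
    ([complete_fixed_point]).

    In a cubical complex, completeness is replaced by rounding.  Let [x] be
    moved by less than 1/4 by every [g].  In a cube containing [x], round each
    coordinate to 0, 1/2 or 1 with error at most 1/4; let [r] be the resulting
    point, the barycenter of a face.  Then [to r g] is a rounding of [to x g],
    with error at most 1/4 in each coordinate.  Moving from [to x g] to [x]
    along a path of length less than 1/4 increases the error by at most that
    length, so it stays below 1/2.  While the error is below 1/2, every face
    that contains the moving point contains the rounded one, because a
    coordinate equal to 0 or 1 is then rounded to itself; so passing from one
    cube to the next never loses the rounded point
    ([pl_path_near_center]).  Hence every cube containing [x] contains the
    whole orbit of [r], which is finite, and the mean of this orbit in one such
    cube is fixed ([orbit_in_cell_fixed]).

    Both the rounding and the mean are compatible with gluings and with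
    automorphisms because an isometry between faces of cubes acts on each
    coordinate separately, up to a renumbering and reflections
    ([face_isometry_coord]). *)

(** * Actions on infinite types *)


Section InfiniteActions.
Variables (gT : finGroupType) (T : Type) (to : {action gT &-> T}).

Lemma action_mul x g h : to x (g * h)%g = to (to x g) h.
Proof. by case: to => f [_ fM] /=; apply: fM; rewrite inE. Qed.

Lemma action_one x : to x 1%g = x.
Proof.
have to_inj : left_injective to by case: to => f [].
by apply: (to_inj 1%g); rewrite -action_mul mulg1.
Qed.

End InfiniteActions.

(** * Isometries between faces of cubes *)

Section Euclidean.
Variable R : realType.

Definition sq_dist n (x y : 'rV[R]_n) : R :=
  \sum_(i < n) (x ord0 i - y ord0 i) ^+ 2.

Definition dot_from n (v x y : 'rV[R]_n) : R :=
  \sum_(i < n) (x ord0 i - v ord0 i) * (y ord0 i - v ord0 i).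

Lemma sq_dist_ge0 n (x y : 'rV[R]_n) : 0 <= sq_dist x y.
Proof. by apply: sumr_ge0 => i _; rewrite sqr_ge0. Qed.

Lemma eucl_dist_sqr n (x y : 'rV[R]_n) : eucl_dist x y ^+ 2 = sq_dist x y.
Proof. by rewrite sqr_sqrtr // sq_dist_ge0. Qed.

Lemma dot_fromE n (v x y : 'rV[R]_n) :
  dot_from v x y = (sq_dist v x + sq_dist v y - sq_dist x y) / 2.
Proof.
rewrite /sq_dist -big_split /= -sumrB mulr_suml.
by apply: eq_bigr => i _; field.
Qed.

Lemma isometry_dot m n (A : set 'rV[R]_m) (B : set 'rV[R]_n) h v x y :
  isometry_onto A B h -> A v -> A x -> A y ->
  dot_from (h v) (h x) (h y) = dot_from v x y.
Proof.
by move=> [_ hd] Av Ax Ay; rewrite !dot_fromE -!eucl_dist_sqr !hd.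
Qed.

Lemma coord_le_eucl_dist n (x y : 'rV[R]_n) i :
  `|x ord0 i - y ord0 i| <= eucl_dist x y.
Proof.
rewrite -sqrtr_sqr ler_wsqrtr // (bigD1 i) //= lerDl.
by apply: sumr_ge0 => j _; rewrite sqr_ge0.
Qed.

Definition update n (x : 'rV[R]_n) (i : 'I_n) (t : R) : 'rV[R]_n :=
  \row_j if j == i then t else x ord0 j.

Lemma update_eq n (x : 'rV[R]_n) i t : update x i t ord0 i = t.
Proof. by rewrite mxE eqxx. Qed.

Lemma update_neq n (x : 'rV[R]_n) i t j : j != i ->
  update x i t ord0 j = x ord0 j.
Proof. by rewrite mxE => /negPf ->. Qed.

Lemma dot_update n (v x y : 'rV[R]_n) i :
  (forall j, j != i -> y ord0 j = v ord0 j) ->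
  dot_from v x y = (x ord0 i - v ord0 i) * (y ord0 i - v ord0 i).
Proof.
move=> yv; rewrite /dot_from (bigD1 i) //= big1 ?addr0 // => j ji.
by rewrite yv // subrr mulr0.
Qed.

Definition vertex n (v : 'rV[R]_n) : Prop :=
  forall i, v ord0 i = 0 \/ v ord0 i = 1.

(** Seen from a vertex, a face lies in an orthant, while at any other point
    some free coordinate can be moved in two opposite directions.  This
    describes the vertices by scalar products alone, so isometries between
    faces preserve them. *)
Lemma vertexP n (F : {ffun 'I_n -> option bool}) (v : 'rV[R]_n) :
  face R F v ->
  (vertex v <-> forall x y, face R F x -> face R F y -> 0 <= dot_from v x y).
Proof.
move=> [cv Fv]; split=> [vv x y [cx _] [cy _]|dot_ge0 i].
  apply: sumr_ge0 => i _; move: (cx i) (cy i) => /andP[x0 x1] /andP[y0 y1].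
  by case: (vv i) => ->; nra.
have face_update t : F i = None -> 0 <= t <= 1 -> face R F (update v i t).
  move=> Fi t01; split=> [j|j b Fj]; rewrite mxE; case: eqP => [ji|_] //.
  - by move: Fj; rewrite ji Fi.
  - exact: Fv.
case Fi : (F i) => [b|]; first by rewrite (Fv i b Fi); case: b {Fi}; [right|left].
have := dot_ge0 _ _ (face_update 0 Fi _) (face_update 1 Fi _).
rewrite !lexx ler01 => /(_ isT isT); rewrite (@dot_update _ _ _ _ i); last first.
  by move=> j ji; rewrite update_neq.
rewrite !update_eq => dot0; case/andP: (cv i) => v0 v1.
have : v ord0 i * (1 - v ord0 i) == 0 by rewrite eq_le; apply/andP; split; nra.
by rewrite mulf_eq0 subr_eq0 => /orP[/eqP ?|/eqP ?]; [left|right].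
Qed.

(** The squared distance of two vertices counts their differing coordinates. *)
Lemma adjacent_vertices n (v w : 'rV[R]_n) :
  vertex v -> vertex w -> sq_dist v w = 1 ->
  exists2 i, v ord0 i != w ord0 i &
    forall j, j != i -> w ord0 j = v ord0 j.
Proof.
move=> vv vw d1.
have [i vwi] : exists i, v ord0 i != w ord0 i.
  apply: contrapT => /forallNP vweq; move: d1; rewrite /sq_dist big1 => [|i _].
    by move/esym/eqP; rewrite oner_eq0.
  by have /negP/negPn/eqP -> := vweq i; rewrite subrr expr0n.
exists i => // j ji; move: d1; rewrite /sq_dist (bigD1 i) //=.
have -> : (v ord0 i - w ord0 i) ^+ 2 = 1.
  case: (vv i) (vw i) vwi => -> [] ->; rewrite ?eqxx // => _.
    by rewrite sub0r sqrrN expr1n.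
  by rewrite subr0 expr1n.
move/eqP; rewrite -subr_eq0 addrAC subrr add0r => /eqP.
move/psumr_eq0P => /(_ (fun i _ => sqr_ge0 _)) /(_ j ji) /eqP.
by rewrite sqrf_eq0 subr_eq0 => /eqP.
Qed.

(** If coordinate [j] is free in the target, take an edge of the target in
    direction [j].  Its ends are the images of two vertices at distance 1, that
    is, of the ends of an edge in some direction [i].  The scalar product with
    an edge reads off the corresponding coordinate, up to the orientation of
    the edge, and the isometry preserves it. *)
Lemma face_isometry_coord m n (F : {ffun 'I_m -> option bool})
    (F' : {ffun 'I_n -> option bool}) h (j : 'I_n) :
  isometry_onto (face R F) (face R F') h ->
  [\/ exists b : bool, forall x, face R F x -> h x ord0 j = b%:R,
      exists i, forall x, face R F x -> h x ord0 j = x ord0 i |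
      exists i, forall x, face R F x -> h x ord0 j = 1 - x ord0 i].
Proof.
move=> hiso; have [him _] := hiso.
have hF x : face R F x -> face R F' (h x) by move=> Fx; rewrite -him; exists x.
case F'j : (F' j) => [b|].
  by apply: Or31; exists b => x /hF[_]; exact.
pose v : 'rV[R]_n := \row_k if F' k is Some b then b%:R else 0.
pose v1 := update v j 1.
have v_vertex : vertex v.
  by move=> k; rewrite mxE; case: (F' k) => [[]|]; [right|left|left].
have v1_vertex : vertex v1.
  by move=> k; rewrite mxE; case: eqP => _; [right|exact: v_vertex].
have vertex_cube w : vertex w -> @cube R n w.
  by move=> wv k; case: (wv k) => ->; rewrite ?lexx ?ler01.
have F'v : face R F' v.
  by split=> [|k b F'k]; [exact: vertex_cube|rewrite mxE F'k].
have F'v1 : face R F' v1.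
  split=> [|k b F'k]; [exact: vertex_cube|rewrite mxE].
  by case: eqP => [kj|_]; [move: F'k; rewrite kj F'j|rewrite mxE F'k].
have vj : v ord0 j = 0 by rewrite mxE F'j.
have v1j : v1 ord0 j = 1 by rewrite update_eq.
move: (F'v) (F'v1); rewrite -him => -[w Fw hw] [w1 Fw1 hw1].
have pull z : face R F z -> vertex (h z) -> vertex z.
  move=> Fz /(vertexP (hF z Fz)) zv; apply/(vertexP Fz) => x y Fx Fy.
  by rewrite -(isometry_dot hiso) //; apply: zv; exact: hF.
have w_vertex : vertex w by apply: pull => //; rewrite hw.
have w1_vertex : vertex w1 by apply: pull => //; rewrite hw1.
have d1 : sq_dist w w1 = 1.
  have [_ hd] := hiso; rewrite -eucl_dist_sqr -hd // hw hw1 eucl_dist_sqr.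
  rewrite /sq_dist (bigD1 j) //= big1 => [|k kj]; last first.
    by rewrite update_neq // subrr expr0n.
  by rewrite vj v1j sub0r sqrrN expr1n addr0.
have [i wi wne] := adjacent_vertices w_vertex w1_vertex d1.
have hx x : face R F x ->
    h x ord0 j = (x ord0 i - w ord0 i) * (w1 ord0 i - w ord0 i).
  move=> Fx; rewrite -dot_update // -(isometry_dot hiso) // hw hw1.
  rewrite (@dot_update _ _ _ _ j) => [|k kj]; last by rewrite update_neq.
  by rewrite vj v1j !subr0 mulr1.
case: (w_vertex i) (w1_vertex i) wi => wi [] w1i; rewrite wi w1i ?eqxx // => _.
  by apply: Or32; exists i => x /hx ->; rewrite wi w1i !subr0 mulr1.
by apply: Or33; exists i => x /hx ->; rewrite wi w1i sub0r mulrN1 opprB.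
Qed.

(** For points of the cube: being the barycenter of a face. *)
Definition half_integer n (p : 'rV[R]_n) : Prop :=
  forall i, [\/ p ord0 i = 0, p ord0 i = 1 / 2 | p ord0 i = 1].

Lemma face_isometry_half_integer m n (F : {ffun 'I_m -> option bool})
    (F' : {ffun 'I_n -> option bool}) h p :
  isometry_onto (face R F) (face R F') h -> face R F p ->
  half_integer p -> half_integer (h p).
Proof.
move=> hiso Fp pp j.
have [[b]|[i]|[i]] := face_isometry_coord j hiso => /(_ p Fp) ->.
- by case: b; [apply: Or33|apply: Or31].
- exact: pp.
- case: (pp i) => ->; [apply: Or33|apply: Or32|apply: Or31]; lra.
Qed.

Lemma face_isometry_sup m n (F : {ffun 'I_m -> option bool})
    (F' : {ffun 'I_n -> option bool}) h c x y :
  isometry_onto (face R F) (face R F') h -> face R F x -> face R F y ->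
  0 <= c -> (forall i, `|x ord0 i - y ord0 i| <= c) ->
  forall j, `|h x ord0 j - h y ord0 j| <= c.
Proof.
move=> hiso Fx Fy c0 xy j.
have [[b]|[i]|[i]] := face_isometry_coord j hiso => hE; rewrite !hE //.
- by rewrite subrr normr0.
- by rewrite opprB addrC addrA subrK distrC.
Qed.

Definition mean (I : finType) n (p : I -> 'rV[R]_n) : 'rV[R]_n :=
  #|I|%:R^-1 *: \sum_(k : I) p k.

Lemma mean_coord (I : finType) n (p : I -> 'rV[R]_n) i :
  mean p ord0 i = #|I|%:R^-1 * \sum_(k : I) p k ord0 i.
Proof. by rewrite /mean mxE summxE. Qed.

Lemma mean_const (I : finType) (c : R) : (0 < #|I|)%N ->
  #|I|%:R^-1 * \sum_(k : I) c = c.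
Proof.
by move=> I0; rewrite sumr_const -(mulr_natl c) mulKf // pnatr_eq0 -lt0n.
Qed.

Lemma face_mean (I : finType) n (F : {ffun 'I_n -> option bool})
    (p : I -> 'rV[R]_n) : (0 < #|I|)%N ->
  (forall k, face R F (p k)) -> face R F (mean p).
Proof.
move=> I0 Fp; split=> [i|i b Fi]; rewrite mean_coord; last first.
  rewrite -[RHS](mean_const b%:R I0); congr (_ * _).
  by apply: eq_bigr => k _; have [_] := Fp k; exact.
have [p0 p1] : (forall k, 0 <= p k ord0 i) /\ (forall k, p k ord0 i <= 1).
  by split=> k; have [/(_ i)/andP[]] := Fp k.
rewrite mulr_ge0 ?invr_ge0 ?ler0n ?sumr_ge0 //=.
rewrite -[leRHS](mean_const 1 I0) ler_wpM2l ?invr_ge0 ?ler0n //.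
exact: ler_sum.
Qed.

Lemma face_isometry_mean (I : finType) m n (F : {ffun 'I_m -> option bool})
    (F' : {ffun 'I_n -> option bool}) h (p : I -> 'rV[R]_m) :
  (0 < #|I|)%N -> isometry_onto (face R F) (face R F') h ->
  (forall k, face R F (p k)) -> h (mean p) = mean (h \o p).
Proof.
move=> I0 hiso Fp; have Fm := face_mean I0 Fp.
apply/rowP => j; rewrite mean_coord.
have [[b]|[i]|[i]] := face_isometry_coord j hiso => hE; rewrite hE //.
- rewrite -[LHS](mean_const b%:R I0); congr (_ * _).
  by apply: eq_bigr => k _; rewrite /= hE.
- by rewrite mean_coord; congr (_ * _); apply: eq_bigr => k _; rewrite /= hE.
- rewrite -[X in X - _](mean_const 1 I0) mean_coord -mulrBr -sumrB.
  by congr (_ * _); apply: eq_bigr => k _; rewrite /= hE.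
Qed.

Definition full_face n : {ffun 'I_n -> option bool} := [ffun=> None].

Lemma full_faceE n : face R (full_face n) = @cube R n.
Proof.
apply/seteqP; split=> [x [] //|x cx]; split=> // i b; by rewrite ffunE.
Qed.

End Euclidean.

(** * Rounding in cubical complexes *)

Section Cubical.
Variables (R : realType) (K : Type) (C : cubical_complex R K).

(** The point [r] is a rounding of [x], with error at most [c], in at least one
    cube; [near_center_cell] makes this independent of the cube. *)
Definition near_center (c : R) (x r : K) : Prop :=
  exists (l : cell C) (a p : 'rV[R]_(dim l)),
    [/\ cube a /\ x = char a, cube p /\ r = char p, half_integer p &
        forall i, `|a ord0 i - p ord0 i| <= c].

Lemma near_center_exists x : exists r, near_center (1 / 4) x r.
Proof.
have [l [a [ca <-]]] := char_surj C x.
pose round (t : R) : R :=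
  if t <= 1 / 4 then 0 else if t < 3 / 4 then 1 / 2 else 1.
pose p : 'rV[R]_(dim l) := \row_i round (a ord0 i).
have p_half : half_integer p.
  move=> i; rewrite mxE /round.
  by case: ifP => _; [exact: Or31|case: ifP => _; [exact: Or32|exact: Or33]].
exists (char p), l, a, p; split=> //.
  by split=> // i; case: (p_half i) => ->; lra.
move=> i; rewrite mxE /round; have /andP[a0 a1] := ca i; rewrite ler_norml.
case: (lerP (a ord0 i) (1 / 4)) => [?|?]; first lra.
by case: (ltrP (a ord0 i) (3 / 4)) => ?; lra.
Qed.

(** For [c < 1/2] the cube in [near_center] may be any cube that contains [x]:
    a coordinate of [x] equal to 0 or 1 is then rounded to itself, so [r] lies
    in each face that contains [x], in particular in the face along which the
    two cubes are glued. *)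
Lemma near_center_cell c x r (m : cell C) (a : 'rV[R]_(dim m)) :
  0 <= c < 1 / 2 -> near_center c x r -> cube a -> x = char a ->
  exists p : 'rV[R]_(dim m),
    [/\ cube p, r = char p, half_integer p &
        forall i, `|a ord0 i - p ord0 i| <= c].
Proof.
move=> /andP[c0 c2] [l [b [p [[cb xb] [cp rp] p_half bp]]]] ca xa.
have ba : char b = char a by rewrite -xb.
have [F [F' [h [hiso glue]]]] :=
  char_glue (ex_intro _ b (ex_intro _ a (And3 cb ca ba))).
have [Fb ah] := (glue _ _ cb ca).1 ba.
have Fp : face R F p.
  split=> // i e Fi; have [_ /(_ i e Fi) be] := Fb.
  have := bp i; rewrite be => /le_lt_trans/(_ c2).
  by rewrite ltr_norml; case: (p_half i) e {Fi be} => -> [] /= ?; lra.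
have [him _] := hiso; have F'hp : face R F' (h p) by rewrite -him; exists p.
have chp : cube (h p) by case: F'hp.
exists (h p); split=> //.
- by rewrite rp; apply/glue.
- exact: face_isometry_half_integer hiso Fp p_half.
- by rewrite ah; apply: face_isometry_sup hiso Fb Fp c0 bp.
Qed.

Lemma automorphism_near_center c f x r :
  0 <= c -> maps_cubes C f -> near_center c x r -> near_center c (f x) (f r).
Proof.
move=> c0 fC [l [a [p [[ca ->] [cp ->] p_half ap]]]].
have [m [F [h [hiso hE]]]] := fC l.
have [him _] := hiso; move: hiso; rewrite -full_faceE => hiso.
have hF y : cube y -> face R F (h y) by move=> cy; rewrite -him; exists y.
have ca' : face R (full_face (dim l)) a by rewrite full_faceE.
have cp' : face R (full_face (dim l)) p by rewrite full_faceE.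
exists m, (h a), (h p); rewrite !hE //; split.
- by split=> //; have [] := hF a ca.
- by split=> //; have [] := hF p cp.
- exact: face_isometry_half_integer hiso cp' p_half.
- exact: face_isometry_sup hiso ca' cp' c0 ap.
Qed.

Lemma pl_path_ge0 x y len : pl_path C x y len -> 0 <= len.
Proof. by elim=> // *; rewrite addr_ge0 ?sqrtr_ge0. Qed.

(** Along a segment in a cube no coordinate changes by more than the length of
    the segment; between segments, [near_center_cell] changes the cube. *)
Lemma pl_path_near_center c x y r len :
  pl_path C x y len -> 0 <= c -> c + len < 1 / 2 ->
  near_center c y r -> near_center (c + len) x r.
Proof.
move=> xy c0; elim: xy => {x y len} [x|l a b y len ca cb by_ IH] clen yr.
  by rewrite addr0.
have d0 : 0 <= eucl_dist a b by exact: sqrtr_ge0.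
have len0 := pl_path_ge0 by_.
have clen2 : c + len < 1 / 2 by lra.
have clen0 : 0 <= c + len < 1 / 2 by rewrite clen2 andbT addr_ge0.
have [p [cp rp p_half bp]] := near_center_cell clen0 (IH clen2 yr) cb erefl.
exists l, a, p; split=> // i.
have := coord_le_eucl_dist a b i; have := bp i.
have := ler_normD (a ord0 i - b ord0 i) (b ord0 i - p ord0 i).
by rewrite addrA subrK; lra.
Qed.

Lemma path_dist_automorphism f x y : maps_cubes C f ->
  (path_dist C (f x) (f y) <= path_dist C x y)%E.
Proof.
move=> fC; apply: ereal_inf_le_tmp => _ [len xy <-]; exists len => //=.
elim: xy => {x y len} [x|l a b y len ca cb _ IH]; first exact: pl_path_const.
have [m [F [h [[him hd] hE]]]] := fC l.
have hc z : cube z -> cube (h z).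
  by move=> cz; have [] : face R F (h z) by rewrite -him; exists z.
rewrite hE // -hd //; apply: pl_path_segment; try exact: hc.
by rewrite -hE.
Qed.

(** An element [g] maps the cube [l] to another cube, and the face common to
    both contains the orbit of [r] and hence its mean, computed in either cube,
    since the gluing preserves means.  As [g] also preserves means and permutes
    the orbit, it fixes that point. *)
Lemma orbit_in_cell_fixed (gT : finGroupType) (to : {action gT &-> K})
    (r : K) (l : cell C) :
  acts_by_automorphisms C to ->
  (forall g, exists2 p : 'rV[R]_(dim l), cube p & to r g = char p) ->
  exists x, fixed_points to x.
Proof.
move=> toC rl.
have /choice[p pP] g : exists p : 'rV[R]_(dim l), cube p /\ to r g = char p.
  by have [q cq rq] := rl g; exists q.
have cp g := (pP g).1; have rp g := (pP g).2.
have G0 : (0 < #|gT|)%N by apply/card_gt0P; exists 1%g.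
have full y : cube y -> face R (full_face (dim l)) y by rewrite full_faceE.
have cm : cube (mean p) by have [] := face_mean G0 (fun g => full _ (cp g)).
exists (char (mean p)) => g.
have [_ [_ _ gC _]] := toC g; have [m [F0 [h [hiso /= hE]]]] := gC l.
have [him _] := hiso; move: hiso; rewrite -full_faceE => hiso.
have ch y : cube y -> cube (h y).
  by move=> cy; have [] : face R F0 (h y) by rewrite -him; exists y.
(* Both cubes contain the orbit: [to r k] has coordinates [p k] in the first,
   and [h (p (k * g^-1))] in the second. *)
have hp k : char (p k) = char (h (p (k * g^-1)%g)).
  by rewrite -hE // -!rp -action_mul mulgKV.
have [F [F' [k [kiso glue]]]] :=
  char_glue (ex_intro _ _ (ex_intro _ _ (And3 (cp 1%g) (ch _ (cp _)) (hp 1%g)))).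
have Fkp q := (glue _ _ (cp q) (ch _ (cp _))).1 (hp q).
have Fp q : face R F (p q) := (Fkp q).1.
rewrite hE //; apply/esym/glue => //; first exact: ch.
split; first exact: face_mean.
rewrite (face_isometry_mean G0 hiso) => [|q]; last exact: full.
rewrite (face_isometry_mean G0 kiso) //; congr (_ *: _).
rewrite (reindex_inj (mulIg g^-1%g)) /=.
by apply: eq_bigr => q _; rewrite (Fkp q).2.
Qed.

Lemma almost_fixed_cubical (gT : finGroupType) (to : {action gT &-> K}) x :
  acts_by_automorphisms C to ->
  (forall g, (path_dist C x (to x g) < (1 / 4)%:E)%E) ->
  exists z, fixed_points to z.
Proof.
move=> toC xg; have [r xr] := near_center_exists x.
have [l [a [ca xa]]] := char_surj C x.
apply: (orbit_in_cell_fixed (r := r) (l := l) toC) => g.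
have [_ [_ _ gC _]] := toC g.
have gxr : near_center (1 / 4) (to x g) (to r g).
  by apply: (@automorphism_near_center _ (to^~ g)) => //; lra.
have [_ [len xgx <-]] := ereal_inf_lt (xg g); rewrite lte_fin => len4.
have len0 := pl_path_ge0 xgx.
have len2 : 1 / 4 + len < 1 / 2 by lra.
have len_ge0 : 0 <= 1 / 4 + len < 1 / 2 by lra.
have near_x : near_center (1 / 4 + len) x (to r g).
  by apply: pl_path_near_center xgx _ len2 gxr; lra.
have [p [cp rp _ _]] := near_center_cell len_ge0 near_x ca (esym xa).
by exists p.
Qed.

End Cubical.

(** * Comparison with the Euclidean plane *)

Section PlaneTriangles.
Variable R : realType.

Lemma eucl_dist_cone n (x y a : 'rV[R]_n) t : t <= 1 ->
  eucl_dist ((1 - t) *: x + t *: a) ((1 - t) *: y + t *: a) =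
  (1 - t) * eucl_dist x y.
Proof.
move=> t1; rewrite /eucl_dist.
have -> : \sum_(i < n) (((1 - t) *: x + t *: a) ord0 i -
    ((1 - t) *: y + t *: a) ord0 i) ^+ 2 = (1 - t) ^+ 2 * sq_dist x y.
  by rewrite mulr_sumr; apply: eq_bigr => i _; rewrite !mxE; ring.
by rewrite sqrtrM ?sqr_ge0 // sqrtr_sqr ger0_norm // subr_ge0.
Qed.

Lemma eucl_dist_midpoint n (x y z : 'rV[R]_n) :
  eucl_dist z ((1 - 1 / 2) *: x + (1 / 2) *: y) ^+ 2 =
  (eucl_dist z x ^+ 2 + eucl_dist z y ^+ 2) / 2 - eucl_dist x y ^+ 2 / 4.
Proof.
rewrite !eucl_dist_sqr /sq_dist -big_split /= !mulr_suml -sumrB.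
by apply: eq_bigr => i _; rewrite !mxE; field.
Qed.

Definition plane_point (u v : R) : 'rV[R]_2 :=
  \row_i (if i == ord0 then u else v).

Lemma eucl_dist_plane u v u' v' d : 0 <= d ->
  (u - u') ^+ 2 + (v - v') ^+ 2 = d ^+ 2 ->
  eucl_dist (plane_point u v) (plane_point u' v') = d.
Proof.
move=> d0 dE; rewrite /eucl_dist !big_ord_recl big_ord0 !mxE /= addr0 dE.
by rewrite sqrtr_sqr ger0_norm.
Qed.

(** The apex of a triangle with sides [a], [b], [c], whose base of length [a]
    runs from the origin along the first axis. *)
Lemma plane_triangle a b c : 0 <= a -> 0 <= b -> 0 <= c ->
  a <= b + c -> b <= a + c -> c <= a + b ->
  exists u v : R, u ^+ 2 + v ^+ 2 = b ^+ 2 /\ (a - u) ^+ 2 + v ^+ 2 = c ^+ 2.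
Proof.
move=> a0 b0 c0 abc bac cab; case: (ltrP 0 a) => [a_gt0|a_le0]; last first.
  have a_eq0 : a = 0 by lra.
  have bc : b = c by lra.
  by exists b, 0; rewrite a_eq0 bc; split; ring.
(* The law of cosines. *)
pose u := (a ^+ 2 + b ^+ 2 - c ^+ 2) / (2 * a).
have uE : 2 * a * u = a ^+ 2 + b ^+ 2 - c ^+ 2.
  by rewrite /u mulrC divfK // mulf_neq0 ?gt_eqF.
have ub : u <= b by rewrite -(ler_pM2l (_ : 0 < 2 * a)) ?uE; nra.
have bu : - b <= u by rewrite -(ler_pM2l (_ : 0 < 2 * a)) ?uE; nra.
exists u, (Num.sqrt (b ^+ 2 - u ^+ 2)); rewrite sqr_sqrtr; last nra.
by split; nra.
Qed.

End PlaneTriangles.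

(** * Convexity in CAT(0) spaces *)

Section CAT0Geometry.
Variables (R : realType) (X : metricType R).

Let o0 : 'I_3 := Ordinal (isT : 0 < 3)%N.
Let o1 : 'I_3 := Ordinal (isT : 1 < 3)%N.
Let o2 : 'I_3 := Ordinal (isT : 2 < 3)%N.

Let ord3P (P : 'I_3 -> Prop) : P o0 -> P o1 -> P o2 -> forall i, P i.
Proof.
move=> P0 P1 P2 [[|[|[|//]]] lti].
- by rewrite (_ : Ordinal _ = o0) //; apply: val_inj.
- by rewrite (_ : Ordinal _ = o1) //; apply: val_inj.
- by rewrite (_ : Ordinal _ = o2) //; apply: val_inj.
Qed.

Let ordS0 : ordS o0 = o1. Proof. exact: val_inj. Qed.
Let ordS1 : ordS o1 = o2. Proof. exact: val_inj. Qed.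
Let ordS2 : ordS o2 = o0. Proof. exact: val_inj. Qed.

Let triple (T : Type) (x0 x1 x2 : T) (i : 'I_3) : T :=
  match nat_of_ord i with 0%N => x0 | 1%N => x1 | _ => x2 end.

Lemma comparison_triangle_exists (v : 'I_3 -> X) :
  exists w, comparison_triangle v w.
Proof.
have [||||||u [t [ut1 ut2]]] := @plane_triangle R (mdist (v o0) (v o1))
  (mdist (v o0) (v o2)) (mdist (v o1) (v o2)); rewrite ?mdist_ge0 //.
- by rewrite (metric_sym (v o1) (v o2)) metric_triangle.
- exact: metric_triangle.
- by rewrite (metric_sym (v o0) (v o1)) metric_triangle.
exists (triple (plane_point 0 0) (plane_point (mdist (v o0) (v o1)) 0)
  (plane_point u t)).
elim/ord3P; elim/ord3P; rewrite /triple /=; apply: eucl_dist_plane;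
  rewrite ?mdist_ge0 ?mdistxx // ?(metric_sym (v o1) (v o0))
    ?(metric_sym (v o2)) -?ut1 -?ut2; ring.
Qed.

Lemma geodesic_reverse (x y : X) c :
  geodesic x y c -> geodesic y x (fun s => c (mdist y x - s)).
Proof.
rewrite /geodesic (metric_sym y x) => -[c0 c1 cd]; split.
- by rewrite subr0.
- by rewrite subrr.
- move=> s t s01 t01; rewrite cd; [|lra|lra].
  by rewrite opprB addrC addrA subrK distrC.
Qed.

Lemma geodesic_isometry (f : X -> X) (x y : X) c :
  (forall u v, mdist (f u) (f v) = mdist u v) ->
  geodesic x y c -> geodesic (f x) (f y) (f \o c).
Proof.
move=> fd [c0 c1 cd]; rewrite /geodesic fd; split=> /= [||s t s01 t01].
- by rewrite c0.
- by rewrite c1.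
- by rewrite fd cd.
Qed.

Hypothesis X_CAT0 : CAT0 X.

(** The triangle is [x], [a], [y]; in the plane the two sides ending at [a]
    converge linearly.  For [x = y] this says that geodesics are unique. *)
Lemma CAT0_cone (x y a : X) c c' t :
  geodesic x a c -> geodesic y a c' -> 0 <= t <= 1 ->
  mdist (c (t * mdist x a)) (c' (t * mdist y a)) <= (1 - t) * mdist x y.
Proof.
move=> xac yac' /andP[t0 t1]; have [_ geod thin] := X_CAT0.
have [c'' yxc''] := geod y x.
pose v := triple x a y.
pose cs := triple c (fun s => c' (mdist a y - s)) c''.
have [w wv] := comparison_triangle_exists v.
have vcs : geodesic_triangle v cs.
  elim/ord3P; rewrite ?ordS0 ?ordS1 ?ordS2 //.
  exact: geodesic_reverse.
have := @thin v cs w vcs wv o0 o1 t (1 - t).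
rewrite /side_point /comparison_point ordS0 ordS1 /cs /v /triple /=.
have -> : mdist a y - (1 - t) * mdist a y = t * mdist y a.
  by rewrite (metric_sym y a); ring.
have -> : (1 - (1 - t)) *: w o1 + (1 - t) *: w o2 =
    (1 - t) *: w o2 + t *: w o1.
  by rewrite addrC; congr (_ + _ *: _); ring.
rewrite eucl_dist_cone // wv /v /triple /=; apply; lra.
Qed.

(** In the plane this is the parallelogram identity [eucl_dist_midpoint]. *)
Lemma CAT0_midpoint (x y : X) : exists m, forall p,
  mdist p m ^+ 2 <= (mdist p x ^+ 2 + mdist p y ^+ 2) / 2 - mdist x y ^+ 2 / 4.
Proof.
have [_ geod thin] := X_CAT0.
have [c xyc] := geod x y; exists (c (1 / 2 * mdist x y)) => p.
have [c1 ypc1] := geod y p; have [c2 pxc2] := geod p x.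
pose v := triple x y p; pose cs := triple c c1 c2.
have [w wv] := comparison_triangle_exists v.
have vcs : geodesic_triangle v cs.
  by elim/ord3P; rewrite ?ordS0 ?ordS1 ?ordS2.
have := @thin v cs w vcs wv o2 o0 0 (1 / 2).
rewrite /side_point /comparison_point ordS0 ordS2 /cs /v /triple /=.
rewrite mul0r subr0 scale1r scale0r addr0; case: pxc2 => -> _ _.
set m := c _ => le_d.
rewrite -[mdist p x](wv o2 o0) -[mdist p y](wv o2 o1) -[mdist x y](wv o0 o1).
rewrite -eucl_dist_midpoint ler_pXn2r ?nnegrE ?mdist_ge0 ?sqrtr_ge0 //.
by apply: le_d; lra.
Qed.

End CAT0Geometry.

(** * Isometric actions of finite groups *)

Section FixedPoints.
Variables (R : realType) (gT : finGroupType) (X : metricType R).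
Variable to : {action gT &-> X}.
Hypotheses (X_CAT0 : CAT0 X) (to_iso : acts_by_isometries to).

Lemma fixed_points_contractible :
  (exists a, fixed_points to a) -> contractible R (fixed_points to).
Proof.
move=> [a fix_a]; have [_ geod _] := X_CAT0.
have /choice[c cP] x : exists c, geodesic x a c by exact: geod.
have cone x y t : 0 <= t <= 1 ->
    mdist (c x (t * mdist x a)) (c y (t * mdist y a)) <= (1 - t) * mdist x y.
  exact: CAT0_cone.
pose H (tx : R * X) := c tx.2 (tx.1 * mdist tx.2 a).
exists a, H; split=> //.
- apply/subspace_continuousP => -[s x] [/= s01 fix_x].
  apply/metricType_numDomainType.cvgrPdist_lt => e e0.
  have xa0 := mdist_ge0 x a; set D := mdist x a + 1.
  have D0 : 0 < D by rewrite /D; lra.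
  rewrite near_withinE.
  exists (ball s (e / 2 / D), ball x (e / 2)) => /=.
    by split; apply: nbhsx_ballx; rewrite ?divr_gt0.
  move=> [t y] [/= st]; rewrite ballEmdist /= => xy [t01 _].
  have s01' : 0 <= s <= 1 by move: s01; rewrite in_itv.
  have t01' : 0 <= t <= 1 by move: t01; rewrite /= in_itv.
  apply: (le_lt_trans (metric_triangle _ (H (t, x)) _)).
  have [_ _ cd] := cP x.
  have Hst : mdist (H (s, x)) (H (t, x)) <= `|s - t| * D.
    rewrite /H /= cd; [|nra|nra].
    by rewrite -mulrBl normrM (ger0_norm xa0) ler_wpM2l // /D; lra.
  have st' : `|s - t| * D < e / 2 by rewrite -ltr_pdivlMr.
  have := cone x y t t01'; have := mdist_ge0 x y; rewrite /H /= in Hst *.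
  nra.
- move=> t x t01 fix_x g.
  (* By uniqueness, [g] fixes the geodesic from [x] to [a] pointwise. *)
  have gc : geodesic x a (fun s => to (c x s) g).
    have := geodesic_isometry (fun u v => to_iso g u v) (cP x).
    by rewrite fix_x fix_a.
  apply: mdist_positivity; apply/eqP; rewrite eq_le mdist_ge0 andbT.
  have := CAT0_cone X_CAT0 gc (cP x) t01.
  by rewrite mdistxx mulr0.
- by move=> x _; rewrite /H /= mul0r; case: (cP x).
- by move=> x _; rewrite /H /= mul1r; case: (cP x).
Qed.

Definition orbit_energy (x0 x : X) : R := \sum_(g : gT) mdist (to x0 g) x ^+ 2.

Definition almost_center (x0 : X) (d : R) (x : X) : Prop :=
  forall y, orbit_energy x0 x <= orbit_energy x0 y + d.

Lemma orbit_energy_ge0 x0 x : 0 <= orbit_energy x0 x.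
Proof. by apply: sumr_ge0 => g _; rewrite sqr_ge0. Qed.

Lemma orbit_energy_invariant x0 x h :
  orbit_energy x0 (to x h) = orbit_energy x0 x.
Proof.
rewrite /orbit_energy (reindex_inj (mulIg h)) /=.
by apply: eq_bigr => g _; rewrite action_mul to_iso.
Qed.

Lemma almost_center_exists x0 d : 0 < d -> exists x, almost_center x0 d x.
Proof.
move=> d0; pose E := range (orbit_energy x0).
have lbE : has_lbound E by exists 0 => _ [x _ <-]; exact: orbit_energy_ge0.
have infE : has_inf E by split=> //; exists (orbit_energy x0 x0), x0.
have [_ [x _ <-] xd] := inf_adherent d0 infE.
exists x => y; apply: (le_trans (ltW xd)); rewrite lerD2r.
by apply: ge_inf => //; exists y.
Qed.

(** At the midpoint of [x] and [y] the energy is smaller than the mean of the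
    energies at [x] and [y] by [#|gT| * mdist x y ^+ 2 / 4], but it cannot be
    smaller by more than [d]. *)
Lemma almost_center_close x0 d x y :
  almost_center x0 d x -> almost_center x0 d y -> mdist x y ^+ 2 <= 4 * d.
Proof.
move=> xc yc; have [m mP] := CAT0_midpoint X_CAT0 x y.
pose n : R := #|gT|%:R.
have n1 : 1 <= n by rewrite ler1n; apply/card_gt0P; exists 1%g.
have CN : orbit_energy x0 m <=
    (orbit_energy x0 x + orbit_energy x0 y) / 2 - n * (mdist x y ^+ 2 / 4).
  rewrite /n mulr_natl -sumr_const /orbit_energy -big_split /= mulr_suml -sumrB.
  by apply: ler_sum => g _; exact: mP.
have := xc m; have := yc m; have := sqr_ge0 (mdist x y); nra.
Qed.

Lemma almost_center_orbit x0 d x g : almost_center x0 d x ->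
  almost_center x0 d (to x g).
Proof. by move=> xc y; rewrite orbit_energy_invariant. Qed.

Lemma almost_fixed_point e : 0 < e ->
  exists x, forall g, mdist x (to x g) < e.
Proof.
move=> e0; have [[x0 _] _ _] := X_CAT0.
have [|x xc] := @almost_center_exists x0 (e ^+ 2 / 8).
  by rewrite divr_gt0 ?exprn_gt0.
exists x => g; have := almost_center_close xc (almost_center_orbit g xc).
by have := mdist_ge0 x (to x g); nra.
Qed.

Lemma complete_fixed_point : complete_space X -> exists x, fixed_points to x.
Proof.
move=> X_complete; have [[x0 _] _ _] := X_CAT0.
have /choice[u uP] (n : nat) : exists x, almost_center x0 n.+1%:R^-1 x.
  by apply: almost_center_exists; rewrite invr_gt0.
have close e : 0 < e -> exists N, forall n x, (N <= n)%N ->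
    almost_center x0 n.+1%:R^-1 x -> mdist (u N) x < e.
  move=> e0; have [N eN] : exists N, 4 * N.+1%:R^-1 < e ^+ 2 :> R.
    have [N N_gt] := ltr_add_invr (divr_gt0 (exprn_gt0 2 e0) (ltr0Sn R 3)).
    by exists N; rewrite mulrC -ltr_pdivlMr //; rewrite add0r in N_gt.
  exists N => n x Nn xc.
  have xc' : almost_center x0 N.+1%:R^-1 x.
    move=> y; apply: (le_trans (xc y)); rewrite lerD2l lef_pV2 ?posrE //.
    by rewrite ler_nat.
  rewrite -(@ltr_pXn2r _ 2) ?nnegrE ?mdist_ge0 ?(ltW e0) //.
  exact: le_lt_trans (almost_center_close (uP N) xc') eN.
have [|l ul] := X_complete u.
  apply: cauchy_exP => e e0; have [N uN] := close e e0; exists (u N).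
  by exists N => // n Nn; rewrite /= ballEmdist; exact: uN (uP n).
exists l => g; apply/eqP/negPn/negP; rewrite -mdist_gt0 => e0.
set e := mdist _ _ in e0.
have [N uN] := close (e / 8) (divr_gt0 e0 (ltr0Sn _ _)).
move/metricType_numDomainType.cvgrPdist_lt : ul.
move=> /(_ (e / 8) (divr_gt0 e0 (ltr0Sn _ _))) [M _ uM].
pose n := maxn N M.
have lun : mdist l (u n) < e / 8 by apply: uM; exact: leq_maxr.
have uNn := uN n (u n) (leq_maxl _ _) (uP n).
have uNgn := uN n (to (u n) g) (leq_maxl _ _) (almost_center_orbit g (uP n)).
have := metric_triangle (to l g) (to (u n) g) l; rewrite to_iso.
have := metric_triangle (to (u n) g) (u N) l.
have := metric_triangle (u N) (u n) l.
by rewrite (metric_sym (u n) l) (metric_sym (to (u n) g) (u N)) -/e; lra.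
Qed.

End FixedPoints.

(** An automorphism maps paths to paths of the same length; applied to [g] and
    to its inverse, this bounds the distances from both sides. *)
Lemma automorphisms_isometries (R : realType) (gT : finGroupType)
    (K : metricType R) (C : cubical_complex R K) (to : {action gT &-> K}) :
  has_path_metric C -> acts_by_automorphisms C to -> acts_by_isometries to.
Proof.
move=> KC toC.
have le_mdist g x y : mdist (to x g) (to y g) <= mdist x y.
  have [_ [_ _ gC _]] := toC g.
  by rewrite -lee_fin !KC; exact: (path_dist_automorphism x y gC).
move=> g x y; apply/eqP; rewrite eq_le le_mdist /=.
have := le_mdist g^-1%g (to x g) (to y g).
by rewrite -!action_mul mulgV !action_one.
Qed.

Theorem theoremB11 (R : realType) (gT : finGroupType) :
  (forall (X : metricType R) (to : {action gT &-> X}),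
     CAT0 X -> complete_space X -> acts_by_isometries to ->
     contractible R (fixed_points to))
  /\
  (forall (K : metricType R) (C : cubical_complex R K)
          (to : {action gT &-> K}),
     has_path_metric C -> CAT0 K -> acts_by_automorphisms C to ->
     contractible R (fixed_points to)).
Proof.
split=> [X to X_CAT0 X_complete to_iso|K C to KC K_CAT0 toC].
  by apply: fixed_points_contractible => //; exact: complete_fixed_point.
have to_iso := automorphisms_isometries KC toC.
apply: fixed_points_contractible => //.
have quarter_gt0 : 0 < 1 / 4 :> R by lra.
have [x xg] := almost_fixed_point K_CAT0 to_iso quarter_gt0.
apply: (almost_fixed_cubical (x := x) toC) => g.
by rewrite -KC lte_fin.
Qed.
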